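(* Let $\mathcal C$ be a semi-$\mathcal Z$-prenormal category, and let $\mathcal T$ be a $\mathcal Z$-normal-mono-coreflective (full, replete) subcategory of $\mathcal C$. Then the following are equivalent. (i) $\mathcal T$ is a $\mathcal Z$-torsion subcategory of $\mathcal C$. (ii) $\mathcal T$ is closed under $\mathcal Z$-extensions, i.e. $X\in\mathcal T$ whenever there exists a $\mathcal Z$-exact sequence $A_1\to X\to A_2$ with $A_1,A_2\in\mathcal T$.
   Context: Let $\mathcal C$ be a category and $\mathcal Z$ a full replete subcategory (the trivial objects). A morphism of $\mathcal C$ is $\mathcal Z$-trivial if it factors through an object of $\mathcal Z$. A $\mathcal Z$-kernel of $f\colon A\to B$ is a pair $(K,k\colon K\to A)$ such that $f\circ k$ is $\mathcal Z$-trivial and every $x\colon X\to A$ with $f\circ x$ $\mathcal Z$-trivial factors uniquely as $x=k\circ x'$. A $\mathcal Z$-cokernel is defined dually. A $\mathcal Z$-normal monomorphism (resp. $\mathcal Z$-normal epimorphism) is a morphism that is a $\mathcal Z$-kernel (resp. $\mathcal Z$-cokernel) of some morphism. A sequence $A\xrightarrow{f}B\xrightarrow{g}C$ is $\mathcal Z$-exact if $(A,f)$ is the $\mathcal Z$-kernel of $g$ and $(C,g)$ is the $\mathcal Z$-cokernel of $f$. $\mathcal C$ is semi-$\mathcal Z$-prenormal if $\mathcal Z$ is mono-coreflective in $\mathcal C$ (the inclusion has a right adjoint and the counit components are monomorphisms) and: (1) $\mathcal C$ has pullbacks along $\mathcal Z$-normal monomorphisms; (2) $\mathcal C$ has $\mathcal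 Z$-cokernels of $\mathcal Z$-kernels; (3) the pullback of a $\mathcal Z$-normal epimorphism along a $\mathcal Z$-normal monomorphism is a $\mathcal Z$-normal epimorphism. A $\mathcal Z$-torsion theory on $\mathcal C$ is a pair $(\mathcal T,\mathcal F)$ of full replete subcategories such that every morphism $A\to B$ with $A\in\mathcal T$, $B\in\mathcal F$ is $\mathcal Z$-trivial, and for every object $X$ there is a $\mathcal Z$-exact sequence $A\to X\to B$ with $A\in\mathcal T$ and $B\in\mathcal F$. A subcategory $\mathcal T$ is a $\mathcal Z$-torsion subcategory if there is an $\mathcal F$ such that $(\mathcal T,\mathcal F)$ is a $\mathcal Z$-torsion theory. A full replete subcategory $\mathcal T$ is $\mathcal Z$-normal-mono-coreflective if the inclusion $\mathcal T\hookrightarrow\mathcal C$ has a right adjoint and the components of the counit are $\mathcal Z$-normal monomorphisms. *)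

(* Defs.v *)
Set Implicit Arguments.
Unset Strict Implicit.
Unset Printing Implicit Defensive.

Record Category : Type := {
  Ob :> Type;
  Hom : Ob -> Ob -> Type;
  idm : forall A, Hom A A;
  comp : forall A B C, Hom B C -> Hom A B -> Hom A C;
  comp_idl : forall A B (f : Hom A B), comp (idm B) f = f;
  comp_idr : forall A B (f : Hom A B), comp f (idm A) = f;
  comp_assoc : forall A B C D (h : Hom C D) (g : Hom B C) (f : Hom A B),
    comp h (comp g f) = comp (comp h g) f
}.

Arguments Hom {c} A B.
Arguments idm {c} A.
Arguments comp {c A B C} g f.

Declare Scope cat_scope.
Delimit Scope cat_scope with cat.
Notation "g ∘ f" := (comp g f) (at level 40, left associativity) : cat_scope.
Open Scope cat_scope.

Record Functor (C D : Category) : Type := {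
  fobj :> C -> D;
  fmap : forall A B : C, Hom A B -> Hom (fobj A) (fobj B);
  fmap_id : forall A : C, fmap (idm A) = idm (fobj A);
  fmap_comp : forall (A B E : C) (g : Hom B E) (f : Hom A B),
    fmap (g ∘ f) = fmap g ∘ fmap f
}.

Arguments fmap {C D} _ {A B} f.

(* [Adjunction L R]: L is left adjoint to R. *)
Record Adjunction (C D : Category) (L : Functor C D) (R : Functor D C) : Type := {
  adj_unit : forall X : C, Hom X (R (L X));
  adj_counit : forall Y : D, Hom (L (R Y)) Y;
  adj_unit_natural : forall (X X' : C) (f : Hom X X'),
    fmap R (fmap L f) ∘ adj_unit X = adj_unit X' ∘ f;
  adj_counit_natural : forall (Y Y' : D) (g : Hom Y Y'),
    g ∘ adj_counit Y = adj_counit Y' ∘ fmap L (fmap R g);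
  triangle_L : forall X : C, adj_counit (L X) ∘ fmap L (adj_unit X) = idm (L X);
  triangle_R : forall Y : D, fmap R (adj_counit Y) ∘ adj_unit (R Y) = idm (R Y)
}.

Section Category.

Variable C : Category.

Definition is_iso (A B : C) (f : Hom A B) : Prop :=
  exists g : Hom B A, g ∘ f = idm A /\ f ∘ g = idm B.

Definition is_mono (A B : C) (f : Hom A B) : Prop :=
  forall (X : C) (u v : Hom X A), f ∘ u = f ∘ v -> u = v.

Definition is_pullback (A B M P : C) (f : Hom A B) (m : Hom M B)
    (p : Hom P A) (q : Hom P M) : Prop :=
  f ∘ p = m ∘ q /\
  forall (X : C) (a : Hom X A) (b : Hom X M), f ∘ a = m ∘ b ->
    exists! x : Hom X P, p ∘ x = a /\ q ∘ x = b.

(* A full replete subcategory is given by its class of objects. *)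
Record Subcategory : Type := {
  in_sub :> C -> Prop;
  replete : forall (A B : C) (f : Hom A B), is_iso f -> in_sub A -> in_sub B
}.

Definition full_subcategory (T : Subcategory) : Category := {|
  Ob := {X : C | T X};
  Hom := fun X Y => Hom (proj1_sig X) (proj1_sig Y);
  idm := fun X => idm (proj1_sig X);
  comp := fun X Y W g f => g ∘ f;
  comp_idl := fun X Y f => comp_idl f;
  comp_idr := fun X Y f => comp_idr f;
  comp_assoc := fun X Y W V h g f => comp_assoc h g f
|}.

Definition inclusion (T : Subcategory) : Functor (full_subcategory T) C :=
  @Build_Functor (full_subcategory T) C
    (fun X => proj1_sig X)
    (fun X Y f => f)
    (fun X => eq_refl)
    (fun X Y W g f => eq_refl).

Definition mono_coreflective (T : Subcategory) : Prop :=
  exists (R : Functor C (full_subcategory T)) (adj : Adjunction (inclusion T) R),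
    forall X : C, is_mono (adj_counit adj X).

Variable Z : Subcategory.

Definition is_trivial (A B : C) (f : Hom A B) : Prop :=
  exists (W : C) (u : Hom A W) (v : Hom W B), Z W /\ f = v ∘ u.

Definition is_Zkernel (A B K : C) (f : Hom A B) (k : Hom K A) : Prop :=
  is_trivial (f ∘ k) /\
  forall (X : C) (x : Hom X A), is_trivial (f ∘ x) ->
    exists! x' : Hom X K, x = k ∘ x'.

Definition is_Zcokernel (A B Q : C) (f : Hom A B) (q : Hom B Q) : Prop :=
  is_trivial (q ∘ f) /\
  forall (Y : C) (y : Hom B Y), is_trivial (y ∘ f) ->
    exists! y' : Hom Q Y, y = y' ∘ q.

Definition normal_mono (K A : C) (k : Hom K A) : Prop :=
  exists (B : C) (f : Hom A B), is_Zkernel f k.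

Definition normal_epi (B Q : C) (q : Hom B Q) : Prop :=
  exists (A : C) (f : Hom A B), is_Zcokernel f q.

Definition Zexact (A B D : C) (f : Hom A B) (g : Hom B D) : Prop :=
  is_Zkernel g f /\ is_Zcokernel f g.

Definition normal_mono_coreflective (T : Subcategory) : Prop :=
  exists (R : Functor C (full_subcategory T)) (adj : Adjunction (inclusion T) R),
    forall X : C, normal_mono (adj_counit adj X).

Record semi_prenormal : Prop := {
  Z_mono_coreflective : mono_coreflective Z;
  has_pullbacks_along_normal_monos :
    forall (A B M : C) (f : Hom A B) (m : Hom M B), normal_mono m ->
      exists (P : C) (p : Hom P A) (q : Hom P M), is_pullback f m p q;
  has_cokernels_of_kernels :
    forall (K A : C) (k : Hom K A), normal_mono k ->
      exists (Q : C) (q : Hom A Q), is_Zcokernel k q;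
  normal_epi_pullback :
    forall (A B M P : C) (e : Hom A B) (m : Hom M B) (p : Hom P A) (q : Hom P M),
      normal_epi e -> normal_mono m -> is_pullback e m p q -> normal_epi q
}.

Record torsion_theory (T F : Subcategory) : Prop := {
  torsion_trivial : forall (A B : C) (f : Hom A B), T A -> F B -> is_trivial f;
  torsion_exact : forall X : C,
    exists (A B : C) (f : Hom A X) (g : Hom X B), T A /\ F B /\ Zexact f g
}.

Definition torsion_subcategory (T : Subcategory) : Prop :=
  exists F : Subcategory, torsion_theory T F.

Definition closed_under_extensions (T : Subcategory) : Prop :=
  forall (A1 X A2 : C) (f : Hom A1 X) (g : Hom X A2),
    Zexact f g -> T A1 -> T A2 -> T X.

End Category.

(* Main.v *)
Require Import Defs.

(** Write [t : K -> X] for the [T]-coreflection of [X], which by hypothesis is a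
    normal monomorphism, hence the kernel of its own cokernel as soon as the
    latter exists.  A trivial object [W] always lies in [T], since every map out
    of [W] is trivial and so the identity of [W] factors through [t].

    Torsion implies closed under extensions: if [A1 -> X -> A2] is exact with
    [A1], [A2] torsion, the torsion-free quotient [b : X -> B] is trivial on [A1],
    hence factors through [A2], hence is trivial.  The torsion part of [X], being
    the kernel of a trivial map, is then all of [X].

    Conversely, the only candidate for the torsion-free class consists of the
    objects receiving only trivial maps from [T], and the only candidate for the
    exact sequence is [K -> X -> Q], where [q : X -> Q] is the cokernel of [t].
    What must be shown is that the coreflection [s : S -> Q] is trivial.  Pull [q]
    back along [s] to get [p : P -> X] and [q' : P -> S].  The axioms make [q'] a
    normal epimorphism, and its kernel is again [K]; so [K -> P -> S] is an
    extension of torsion objects and [P] is torsion.  Hence [p] factors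
    through [t], so [s q' = q p] is trivial, so [q'] itself is trivial.  If a
    cokernel is trivial, so is the identity of its codomain
    ([trivial_Zcokernel_id]); hence [s] is trivial
    ([cokernel_of_coreflection_torsion_free]). *)

(** * Trivial morphisms, kernels and cokernels *)

Section Generalities.

Variables (C : Category) (Z : Subcategory C).

Lemma trivial_precomp (A B D : C) (f : Hom A B) (g : Hom B D) :
  is_trivial Z g -> is_trivial Z (g ∘ f).
Proof.
  intros (W & u & v & HW & ->).
  exists W, (u ∘ f), v; split; [exact HW|].
  symmetry; apply comp_assoc.
Qed.

Lemma trivial_postcomp (A B D : C) (f : Hom A B) (g : Hom B D) :
  is_trivial Z f -> is_trivial Z (g ∘ f).
Proof.
  intros (W & u & v & HW & ->).
  exists W, u, (g ∘ v); split; [exact HW|].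
  apply comp_assoc.
Qed.

Lemma Zkernel_mono (A B K : C) (f : Hom A B) (k : Hom K A) :
  is_Zkernel Z f k -> is_mono k.
Proof.
  intros [Htriv Huniv] X u v E.
  assert (Ht : is_trivial Z (f ∘ (k ∘ u))).
  { rewrite comp_assoc; now apply trivial_precomp. }
  destruct (Huniv _ _ Ht) as (w & _ & Hw).
  rewrite <- (Hw u eq_refl); apply Hw, E.
Qed.

Lemma normal_mono_mono (K A : C) (k : Hom K A) : normal_mono Z k -> is_mono k.
Proof. intros (B & f & Hk); exact (Zkernel_mono _ _ _ _ _ Hk). Qed.

Lemma Zcokernel_epi (A B Q : C) (f : Hom A B) (q : Hom B Q) :
  is_Zcokernel Z f q ->
  forall (Y : C) (u v : Hom Q Y), u ∘ q = v ∘ q -> u = v.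
Proof.
  intros [Htriv Huniv] Y u v E.
  assert (Ht : is_trivial Z (u ∘ q ∘ f)).
  { rewrite <- comp_assoc; now apply trivial_postcomp. }
  destruct (Huniv _ _ Ht) as (w & _ & Hw).
  rewrite <- (Hw u eq_refl); apply Hw, E.
Qed.

Lemma split_epi_mono_iso (A B : C) (m : Hom A B) (r : Hom B A) :
  is_mono m -> m ∘ r = idm B -> is_iso m.
Proof.
  intros Hm E; exists r; split; [|exact E].
  apply Hm; rewrite comp_assoc, E, comp_idl, comp_idr; reflexivity.
Qed.

(** The identity of [A] composes with [f] to a trivial map, so it factors through
    [k]; thus [k] is a split epimorphism as well as a monomorphism. *)
Lemma Zkernel_of_trivial_iso (A B K : C) (f : Hom A B) (k : Hom K A) :
  is_Zkernel Z f k -> is_trivial Z f -> is_iso k.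
Proof.
  intros Hk Hf.
  assert (Ht : is_trivial Z (f ∘ idm A)) by now apply trivial_precomp.
  destruct (proj2 Hk _ _ Ht) as (r & Er & _).
  exact (split_epi_mono_iso _ _ _ _ (Zkernel_mono _ _ _ _ _ Hk) (eq_sym Er)).
Qed.

(** If [q = v u] with [u] landing in a trivial object, then [u f] is trivial as
    well, so [u = u' q]; cancelling [q] in [v u' q = q] exhibits [Q] as
    a retract of a trivial object. *)
Lemma trivial_Zcokernel_id (A B Q : C) (f : Hom A B) (q : Hom B Q) :
  is_Zcokernel Z f q -> is_trivial Z q -> is_trivial Z (idm Q).
Proof.
  intros Hq (W & u & v & HW & E).
  assert (Hu : is_trivial Z (u ∘ f)).
  { exists W, (u ∘ f), (idm W); split; [exact HW|].
    symmetry; apply comp_idl. }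
  destruct (proj2 Hq _ _ Hu) as (u' & Eu & _).
  exists W, u', v; split; [exact HW|].
  apply (Zcokernel_epi _ _ _ _ _ Hq).
  rewrite comp_idl, <- comp_assoc, <- Eu; exact E.
Qed.

Lemma normal_mono_Zkernel_of_Zcokernel (K A Q : C) (k : Hom K A) (q : Hom A Q) :
  normal_mono Z k -> is_Zcokernel Z k q -> is_Zkernel Z q k.
Proof.
  intros (B & f & Hf & Hk) [Hq Huniv]; split; [exact Hq|].
  intros X x Hx; apply Hk.
  destruct (Huniv _ _ Hf) as (f' & -> & _).
  rewrite <- comp_assoc; now apply trivial_postcomp.
Qed.

Lemma normal_epi_Zcokernel_of_Zkernel (K A Q : C) (k : Hom K A) (q : Hom A Q) :
  normal_epi Z q -> is_Zkernel Z q k -> is_Zcokernel Z k q.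
Proof.
  intros (B & f & Hf & Hq) [Hk Huniv]; split; [exact Hk|].
  intros Y y Hy; apply Hq.
  destruct (Huniv _ _ Hf) as (f' & -> & _).
  rewrite comp_assoc; now apply trivial_precomp.
Qed.

Lemma pullback_mono (A B M P : C) (f : Hom A B) (m : Hom M B)
    (p : Hom P A) (q : Hom P M) :
  is_pullback f m p q -> is_mono m -> is_mono p.
Proof.
  intros [Hsq Huniv] Hm X u v E.
  assert (Eq : q ∘ v = q ∘ u).
  { apply Hm; rewrite !comp_assoc, <- Hsq, <- !comp_assoc, E; reflexivity. }
  assert (Hc : f ∘ (p ∘ u) = m ∘ (q ∘ u)) by now rewrite !comp_assoc, Hsq.
  destruct (Huniv _ _ _ Hc) as (w & _ & Hw).
  rewrite <- (Hw u (conj eq_refl eq_refl)); apply Hw.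
  split; [symmetry; exact E | exact Eq].
Qed.

(** Since [f p = m q], a map [x] with [q x] trivial has [f (p x)] trivial, so [p x]
    factors through [k = p j]; cancelling the monomorphism [p] factors [x]
    through [j]. *)
Lemma pullback_Zkernel (A B M P K : C) (f : Hom A B) (m : Hom M B)
    (p : Hom P A) (q : Hom P M) (k : Hom K A) (j : Hom K P) :
  is_pullback f m p q -> is_mono m -> is_Zkernel Z f k ->
  p ∘ j = k -> is_trivial Z (q ∘ j) -> is_Zkernel Z q j.
Proof.
  intros Hpb Hm Hk Ej Hj; split; [exact Hj|].
  pose proof (pullback_mono _ _ _ _ _ _ _ _ Hpb Hm) as Hp.
  intros X x Hx.
  assert (Ht : is_trivial Z (f ∘ (p ∘ x))).
  { rewrite comp_assoc, (proj1 Hpb), <- comp_assoc; now apply trivial_postcomp. }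
  destruct (proj2 Hk _ _ Ht) as (y & Ey & Hy).
  exists y; split.
  - apply Hp; rewrite comp_assoc, Ej; exact Ey.
  - intros y' E; apply Hy; rewrite E, comp_assoc, Ej; reflexivity.
Qed.

End Generalities.

(** * Coreflections *)

Section Coreflection.

Variables (C : Category) (Z T : Subcategory C).

(** Weak because factorizations are not required to be unique: uniqueness will
    always come from [t] being a monomorphism. *)
Definition weak_coreflection (K X : C) (t : Hom K X) : Prop :=
  T K /\ forall (A : C) (f : Hom A X), T A -> exists g : Hom A K, f = t ∘ g.

Lemma normal_mono_coreflection (hT : normal_mono_coreflective Z T) (X : C) :
  exists (K : C) (t : Hom K X), normal_mono Z t /\ weak_coreflection K X t.
Proof.
  destruct hT as (R & adj & Hn).
  exists (proj1_sig (R X)), (adj_counit adj X); split; [apply Hn|split].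
  - exact (proj2_sig (R X)).
  - intros A f HA.
    set (A' := exist _ A HA : full_subcategory T).
    (* The transpose of [f] under the adjunction. *)
    exists (fmap R (f : Hom (inclusion T A') X) ∘ adj_unit adj A').
    pose proof (adj_counit_natural adj (f : Hom (inclusion T A') X)) as Hnat.
    pose proof (triangle_L adj A') as Htri.
    cbn in Hnat, Htri |- *.
    rewrite comp_assoc, <- Hnat, <- comp_assoc, Htri.
    symmetry; apply comp_idr.
Qed.

Lemma trivial_object_torsion (hT : normal_mono_coreflective Z T) (W : C) :
  Z W -> T W.
Proof.
  intros HW.
  destruct (normal_mono_coreflection hT W) as (K & t & (B & f & Ht) & HK & _).
  apply (replete (f := t)); [|exact HK].
  apply (Zkernel_of_trivial_iso _ _ _ _ _ _ _ Ht).
  exists W, (idm W), f; split; [exact HW|].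
  symmetry; apply comp_idr.
Qed.

(** A trivial map into [X] passes through an object of [Z], hence of [T], before
    reaching [X]; so it lifts to the coreflection while remaining trivial. *)
Lemma trivial_lift (hT : normal_mono_coreflective Z T) (A K X : C)
    (t : Hom K X) (f : Hom A X) :
  weak_coreflection K X t -> is_trivial Z f ->
  exists g : Hom A K, is_trivial Z g /\ f = t ∘ g.
Proof.
  intros [_ Hfac] (W & u & v & HW & ->).
  destruct (Hfac _ v (trivial_object_torsion hT W HW)) as (v' & ->).
  exists (v' ∘ u); split.
  - exists W, u, v'; split; [exact HW|reflexivity].
  - symmetry; apply comp_assoc.
Qed.

Definition receives_only_trivial (B : C) : Prop :=
  forall (A : C) (f : Hom A B), T A -> is_trivial Z f.

Lemma receives_only_trivial_replete (A B : C) (f : Hom A B) :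
  is_iso f -> receives_only_trivial A -> receives_only_trivial B.
Proof.
  intros (g & _ & E) HA X x HX.
  rewrite <- (comp_idl x), <- E, <- comp_assoc.
  apply trivial_postcomp, HA, HX.
Qed.

Definition torsion_free : Subcategory C :=
  {| in_sub := receives_only_trivial; replete := receives_only_trivial_replete |}.

(** The inverse image [P] in [X] of the torsion part [S]
    of [Q] is an extension of [S] by [K], hence torsion, hence [P -> X] factors
    through [K]; so [S -> Q] is trivial. *)
Lemma cokernel_of_coreflection_torsion_free
    (hC : semi_prenormal Z) (hT : normal_mono_coreflective Z T)
    (hE : closed_under_extensions Z T)
    (K X Q : C) (t : Hom K X) (q : Hom X Q) :
  weak_coreflection K X t -> Zexact Z t q -> torsion_free Q.
Proof.
  intros Ht [Hker Hcok].
  destruct (normal_mono_coreflection hT Q) as (S & s & Hs & HS).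
  pose proof (normal_mono_mono _ _ _ _ _ Hs) as Hsm.
  destruct (has_pullbacks_along_normal_monos hC q Hs) as (P & p & q' & Hpb).
  assert (Hq' : normal_epi Z q').
  { refine (normal_epi_pullback hC _ Hs Hpb); now exists K, t. }
  destruct (trivial_lift hT _ _ _ _ _ HS (proj1 Hcok)) as (w & Hw & Ew).
  destruct (proj2 Hpb _ _ _ Ew) as (j & [Ej Ej'] & _).
  assert (Hj : is_Zkernel Z q' j).
  { apply (pullback_Zkernel _ _ _ _ _ _ _ _ _ _ _ _ _ Hpb Hsm Hker Ej).
    rewrite Ej'; exact Hw. }
  pose proof (normal_epi_Zcokernel_of_Zkernel _ _ _ _ _ _ _ Hq' Hj) as Hjq.
  assert (HP : T P) by exact (hE _ _ _ j q' (conj Hj Hjq) (proj1 Ht) (proj1 HS)).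
  destruct (proj2 Ht _ p HP) as (r & Er).
  assert (Hsq : is_trivial Z (s ∘ q')).
  { rewrite <- (proj1 Hpb), Er, comp_assoc.
    apply trivial_precomp, (proj1 Hcok). }
  assert (Hq't : is_trivial Z q').
  { destruct (trivial_lift hT _ _ _ _ _ HS Hsq) as (g & Hg & Eg).
    rewrite (Hsm _ _ _ Eg); exact Hg. }
  pose proof (trivial_Zcokernel_id _ _ _ _ _ _ _ Hjq Hq't) as Hid.
  intros A f HA.
  destruct (proj2 HS _ f HA) as (g & ->).
  apply trivial_precomp.
  rewrite <- (comp_idr s); now apply trivial_postcomp.
Qed.

End Coreflection.

(** * The characterization of torsion subcategories *)

Lemma torsion_closed_under_extensions (C : Category) (Z T : Subcategory C) :
  torsion_subcategory Z T -> closed_under_extensions Z T.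
Proof.
  intros (F & Htriv & Hex) A1 X A2 f g [_ Hg] H1 H2.
  destruct (Hex X) as (A & B & a & b & HA & HB & Ha & _).
  destruct (proj2 Hg _ b (Htriv _ _ (b ∘ f) H1 HB)) as (b' & Eb & _).
  apply (replete (f := a)); [|exact HA].
  apply (Zkernel_of_trivial_iso _ _ _ _ _ _ _ Ha).
  rewrite Eb; apply trivial_precomp, Htriv; assumption.
Qed.

Theorem proposition3p3 (C : Category) (Z T : Subcategory C)
    (hC : semi_prenormal Z) (hT : normal_mono_coreflective Z T) :
  torsion_subcategory Z T <-> closed_under_extensions Z T.
Proof.
  split; [apply torsion_closed_under_extensions|].
  intros hE; exists (torsion_free C Z T); split.
  - intros A B f HA HB; exact (HB _ f HA).
  - intros X.
    destruct (normal_mono_coreflection _ _ _ hT X) as (K & t & Hn & Ht).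
    destruct (has_cokernels_of_kernels hC Hn) as (Q & q & Hq).
    assert (Hex : Zexact Z t q).
    { split; [|exact Hq]; now apply normal_mono_Zkernel_of_Zcokernel. }
    exists K, Q, t, q; split; [exact (proj1 Ht)|split; [|exact Hex]].
    exact (cokernel_of_coreflection_torsion_free
             _ _ _ hC hT hE _ _ _ _ _ Ht Hex).
Qed.
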